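(* Let $\theta\ge2$ be an integer. For integers $n\ge1$ and $0\le k\le n$, let $C_{n,k}^{(\theta)}$ be the level of containment of the vertex labeled $k$ in a hyperrecursive tree with hyperedge size $\theta$ at age $n$. For every integer $r\ge1$, $$\mathbb{P}\big(C_{n,k}^{(\theta)}=r\big)=\frac{(\theta-1)^{r-1}}{\langle k+\theta\rangle_{n-k}}\sum_{i=r-1}^{n-k}\left[{n-k\atop i}\right]\binom{i}{r-1}(k+1)^{i-r+1}.$$
   Context: Hyperrecursive tree with hyperedge size $\theta$ (an integer $\theta\ge2$): at time $0$ there are $\theta$ originating vertices, all labeled $0$, which together form the first hyperedge. At each time $n\ge1$ a new vertex labeled $n$ is added; a subset of size $\theta-1$ of the $n-1+\theta$ existing vertices is chosen uniformly at random among all subsets of that size (independently of the past), and the new vertex together with the chosen vertices forms a new hyperedge. The structure at time $n$ (right after insertion of vertex $n$) is said to have age $n$. The containment level $C_{n,k}^{(\theta)}$ of vertex $k$ at time $n\ge k$ is the number of hyperedges containing vertex $k$ at time $n$; for $k=0$ one tracks a fixed chosen representative among the $\theta$ originators. Rising factorial: $\langle x\rangle_m=x(x+1)\cdots(x+m-1)$, with $\langle x\rangle_0=1$. $\left[{m\atop i}\right]$ is the signless Stirling number of the first kind, the number of permutations of $\{1,\dots,m\}$ with exactly $i$ cycles (with $\left[{0\atop0}\right]=1$ and $\left[{m\atop0}\right]=0$ for $m\ge1$), so that $\langle x\rangle_m=\sum_{i=0}^m\left[{m\atop i}\right]x^i$. An empty sum is $0$. *)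

(* Defs.v *)
From HB Require Import structures.
From mathcomp Require Import all_boot all_order all_algebra all_fingroup.
From mathcomp Require Import finmap.
From mathcomp Require Import all_classical all_reals all_analysis.

Set Implicit Arguments.
Unset Strict Implicit.
Unset Printing Implicit Defensive.

Import Order.TTheory GRing.Theory Num.Theory.

Local Open Scope classical_set_scope.
Local Open Scope ring_scope.

(* Vertices are natural numbers: the theta originators (all labeled 0 in the
   tree) are 0, ..., theta - 1, and the vertex labeled j >= 1 is
   theta + j - 1. The vertices present at age n are thus exactly the naturals
   below n + theta. *)

(* For k = 0, rho is the tracked originator. *)
Definition vertex (theta rho k : nat) : nat :=
  if k is j.+1 then (theta + j)%N else rho.

Definition existing_vertices (theta n : nat) : {fset nat} :=
  [fset v in iota 0 (n + theta)]%fset.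

Definition uniform_choice (R : realType) (theta n : nat) (A : {fset nat}) : R :=
  if (A `<=` existing_vertices theta n.-1)%fset && (#|` A|%fset == theta.-1)
  then ('C(n.-1 + theta, theta.-1))%:R^-1 else 0.

(* S n w is the set of vertices chosen at time n >= 1 in the outcome w; S 0 is
   never used. *)
Record hyperrecursive_choices (R : realType) (d : measure_display)
    (T : measurableType d) (P : probability T R) (theta : nat)
    (S : nat -> T -> {fset nat}) : Prop := {
  measurable_choice : forall n A, (1 <= n)%N ->
    measurable [set w | S n w = A] ;
  (* Given any past, the choice at time n is uniform. *)
  uniform_choice_indep_past : forall n (A : nat -> {fset nat}), (1 <= n)%N ->
    P [set w | forall j, (1 <= j <= n)%N -> S j w = A j] =
    (P [set w | forall j, (1 <= j < n)%N -> S j w = A j] *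
     (uniform_choice R theta n (A n))%:E)%E }.

Definition originating_hyperedge (theta : nat) : {fset nat} :=
  existing_vertices theta 0.

(* The hyperedges at age n, in order of creation. *)
Definition hyperedges (T : Type) (theta : nat) (S : nat -> T -> {fset nat})
    (n : nat) (w : T) : seq {fset nat} :=
  originating_hyperedge theta ::
    [seq (vertex theta 0 j |` S j w)%fset | j <- iota 1 n].

Definition containment_level (T : Type) (theta rho : nat)
    (S : nat -> T -> {fset nat}) (n k : nat) (w : T) : nat :=
  count (fun e : {fset nat} => vertex theta rho k \in e)
    (hyperedges theta S n w).

Definition rising_factorial (R : pzSemiRingType) (x : R) (m : nat) : R :=
  \prod_(0 <= j < m) (x + j%:R).

(* porbits counts fixed points as cycles. *)
Definition stirling1 (m i : nat) : nat :=
  #|[set s : 'S_m | #|porbits s| == i]%SET|.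

(* Main.v *)
(* Conditionally on the past, the vertex n + 1 joins an existing vertex with
   probability (theta - 1) / (n + theta), so the level of vertex k at age n has
   generating function
     X * prod_(k <= j < n) (j + 1 + (theta - 1) X) / (j + theta)
       = X * <k + 1 + (theta - 1) X>_(n - k) / <k + theta>_(n - k).
   Expanding the rising factorial with Stirling numbers, then each power of
   k + 1 + (theta - 1) X with the binomial formula, the coefficient of X^r is the
   stated probability. All expectations are finite sums, because the history of
   the choices is almost surely uniform on the finite list of admissible ones. *)

Require Import Defs.
From HB Require Import structures.
From mathcomp Require Import all_boot all_order all_algebra all_fingroup.
From mathcomp Require Import finmap.
From mathcomp Require Import all_classical all_reals all_analysis.
From mathcomp Require Import zify ring.

Set Implicit Arguments.
Unset Strict Implicit.
Unset Printing Implicit Defensive.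

Import Order.TTheory GRing.Theory Num.Theory.

Local Open Scope classical_set_scope.
Local Open Scope ring_scope.

(** * Cycle counts of permutations and Stirling numbers *)

Lemma lift_permX m (i : 'I_m.+1) (s : 'S_m) e j :
  ((lift_perm i i s ^+ e) (lift i j) = lift i ((s ^+ e) j))%g.
Proof.
by elim: e => [|e IHe]; rewrite ?expg0 ?perm1 // !expgSr !permM IHe lift_perm_lift.
Qed.

Lemma porbit_lift_perm m (i : 'I_m.+1) (s : 'S_m) j :
  porbit (lift_perm i i s) (lift i j) = lift i @: porbit s j.
Proof.
apply/setP => x; apply/porbitP/imsetP => [[e ->]|[y /porbitP[e ->] ->]].
  by exists ((s ^+ e)%g j); rewrite ?mem_porbit ?lift_permX.
by exists e; rewrite lift_permX.
Qed.

Lemma porbit_lift_perm_id m (i : 'I_m.+1) (s : 'S_m) :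
  porbit (lift_perm i i s) i = [set i]%SET.
Proof.
apply/setP => x; rewrite inE; apply/porbitP/eqP => [[e ->]|->]; last first.
  by exists 0%N; rewrite expg0 perm1.
by elim: e => [|e IHe]; rewrite ?expg0 ?perm1 // expgSr permM IHe lift_perm_id.
Qed.

(** The cycles of [s] survive as their images under [lift i], and the fixed point [i] forms one more
    cycle. *)
Lemma card_porbits_lift_perm m (i : 'I_m.+1) (s : 'S_m) :
  #|porbits (lift_perm i i s)| = #|porbits s|.+1.
Proof.
have -> : porbits (lift_perm i i s) =
    ([set i]%SET |: [set lift i @: (A : {set 'I_m}) | A in porbits s])%SET.
  apply/setP => A; rewrite !inE; apply/imsetP/orP => [[x _ ->]|].
    case: (unliftP i x) => [j|] ->; last by left; rewrite porbit_lift_perm_id.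
    by right; rewrite porbit_lift_perm; do 2!apply: imset_f.
  case=> [/eqP->|/imsetP[B /imsetP[j _ ->] ->]].
    by exists i => //; rewrite porbit_lift_perm_id.
  by exists (lift i j) => //; rewrite porbit_lift_perm.
rewrite cardsU1 card_imset ?add1n; last exact/imset_inj/lift_inj.
suff -> : [set i]%SET \notin [set lift i @: (A : {set 'I_m}) | A in porbits s]%SET.
  by rewrite add1n.
apply/imsetP => -[A _ /setP/(_ i)]; rewrite !inE eqxx => /esym/imsetP[j _].
by move/eqP; rewrite (negPf (neq_lift i j)).
Qed.

Lemma card_porbits_tperm_lift_perm m (i j : 'I_m.+1) (s : 'S_m) :
  #|porbits (tperm i j * lift_perm i i s)%g| = (#|porbits s| + (j == i))%N.
Proof.
have := porbits_mul_tperm (lift_perm i i s) i j.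
rewrite /= card_porbits_lift_perm porbit_sym porbit_lift_perm_id inE eq_sym.
by case: eqP => _ /=; lia.
Qed.

(* Left multiplication by (0 j) of the permutations fixing 0 enumerates 'S_m.+1;
   it merges 0 into the cycle of j, and adds a cycle only when j = 0. *)
Lemma sum_expr_card_porbits (A : comPzRingType) (x : A) m :
  \sum_(s : 'S_m) x ^+ #|porbits s| = rising_factorial x m.
Proof.
elim: m => [|m IHm]; rewrite /rising_factorial.
  rewrite big_geq // (big_pred1 1%g) => [|s]; last first.
    by rewrite /=; apply/esym/eqP/permP => -[].
  by rewrite eq_card0 ?expr0 // => B; rewrite inE; apply/imsetP => -[[]].
rewrite big_nat_recr //= -/(rising_factorial x m) -IHm.
pose h (p : 'I_m.+1 * 'S_m) : 'S_m.+1 := (tperm ord0 p.1 * lift_perm ord0 ord0 p.2)%g.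
(* Both sides have [m.+1 * m!] elements, so injectivity suffices; [j] is recovered from the product
   as the preimage of [ord0]. *)
have h_bij : bijective h.
  apply: inj_card_bij => [[j s] [j' s']|]; last first.
    by rewrite card_prod !card_Sn card_ord factS.
  rewrite /h /= => e.
  have jj' : j = j'.
    apply: (@perm_inj _ (tperm ord0 j * lift_perm ord0 ord0 s)%g).
    by rewrite {2}e !permM !tpermR !lift_perm_id.
  move: e; rewrite jj' => /mulgI e; congr (_, _); apply/permP => y.
  apply: (@lift_inj _ ord0); rewrite -!(lift_perm_lift ord0).
  by rewrite e.
rewrite (reindex h) /=; last exact: onW_bij.
rewrite -(pair_bigA _ (fun j s => x ^+ #|porbits (h (j, s))|)) exchange_big /=.
rewrite mulr_suml; apply: eq_bigr => s _.
(* The index [ord0] contributes a factor [x], each of the [m] other indices a factor 1: together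
   [x + m]. *)
rewrite big_ord_recl card_porbits_tperm_lift_perm eqxx addn1 exprSr mulrDr.
congr (_ + _).
under eq_bigr do rewrite card_porbits_tperm_lift_perm lift_eqF addn0.
by rewrite /= sumr_const card_ord mulr_natr.
Qed.

Lemma rising_factorial_stirling1 (A : comPzRingType) (x : A) m :
  rising_factorial x m = \sum_(i < m.+1) (stirling1 m i)%:R * x ^+ i.
Proof.
have porbits_lt (s : 'S_m) : (#|porbits s| < m.+1)%N.
  by rewrite ltnS (leq_trans (leq_imset_card _ _)) // card_ord.
rewrite -sum_expr_card_porbits.
(* Permutations are grouped by number of cycles; [inord] loses nothing, since there are at most [m]
   cycles. *)
rewrite (partition_big (fun s : 'S_m => inord #|porbits s| : 'I_m.+1) predT) //=.
apply: eq_bigr => i _; rewrite (eq_bigr (fun=> x ^+ i)); last first.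
  by move=> s /eqP <-; rewrite inordK.
rewrite sumr_const mulr_natl; congr (_ *+ _).
rewrite /stirling1 cardsE; apply: eq_card => s.
by rewrite unfold_in /= inordK.
Qed.

(** * Discrete laws with finite support *)

Section discrete_law.
Context (R : realType) (d : measure_display) (T : measurableType d).
Context (P : probability T R) (E : countType) (X : T -> E).
Hypothesis measurable_fiber : forall x, measurable [set w | X w = x].

Lemma measurable_pred_fiber (Q : pred E) : measurable [set w | Q (X w)].
Proof.
have -> : [set w | Q (X w)] =
    \bigcup_x (if Q x then [set w | X w = x] else set0).
  apply/seteqP; split => [w Qw|w [x _]]; last by case: ifP => //= Qx ->.
  by exists (X w) => //=; rewrite (Qw : Q (X w)).
apply: countable_bigcupT_measurable => [|x]; first exact: countableP.
by case: ifP => // _; exact: measurable0.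
Qed.

Lemma probability_pred_mem_seq (Q : pred E) (L : seq E) : uniq L ->
  P [set w | Q (X w) && (X w \in L)] =
  (\sum_(x <- L | Q x) P [set w | X w = x])%E.
Proof.
elim: L => [_|x L IHL /= /andP[xL uL]].
  rewrite big_nil -[RHS](measure0 P); congr (P _).
  by apply/seteqP; split => w //=; rewrite in_nil andbF.
rewrite big_cons -IHL //; case: ifPn => Qx.
  rewrite -measureU //; first last.
  - by apply/seteqP; split => w //= -[->]; rewrite (negPf xL) andbF.
  - exact: (measurable_pred_fiber [pred y | Q y && (y \in L)]).
  congr (P _); apply/seteqP; split => w /=; rewrite in_cons.
    by case/andP => QX /orP[/eqP|XL]; [left|right; apply/andP].
  by case=> [->|/andP[-> ->]]; rewrite ?orbT // eqxx Qx.
congr (P _); apply/seteqP; split => w /=; rewrite in_cons.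
  by case: eqVneq => [->|_] //=; rewrite (negPf Qx).
by case/andP => -> ->; rewrite orbT.
Qed.

Lemma probability_pred_finite_support (Q : pred E) (L : seq E) : uniq L ->
  (\sum_(x <- L) P [set w | X w = x] = 1)%E ->
  P [set w | Q (X w)] = (\sum_(x <- L | Q x) P [set w | X w = x])%E.
Proof.
move=> uL PL1; rewrite -probability_pred_mem_seq //.
pose N := [set w | X w \in L].
have mN : measurable N by exact: (measurable_pred_fiber [in L]).
have PN : P N = 1%E.
  by rewrite -PL1 -(@probability_pred_mem_seq predT).
have -> : [set w | Q (X w)] =
    [set w | Q (X w) && (X w \in L)] `|` ([set w | Q (X w)] `&` ~` N).
  apply/seteqP; split => w /=; last by case=> [/andP[]|[]].
  move=> QX; rewrite QX /=.
  by case: (boolP (X w \in L)) => XL; [left|right; split => //; apply/negP].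
have mQN : measurable ([set w | Q (X w)] `&` ~` N).
  by apply: measurableI; [exact: measurable_pred_fiber|exact: measurableC].
apply: measureU0 => //.
  exact: (measurable_pred_fiber [pred y | Q y && (y \in L)]).
apply: (@subset_measure0 _ _ _ P _ (~` N)) => //; first exact: measurableC.
by rewrite /= probability_setC // PN subee.
Qed.

End discrete_law.

(** * Admissible choices and histories *)

(** Subsets of ['I_m] are enumerated first, so that the counting results on finite types apply, and
    then turned into finite sets of naturals. *)
Definition draws (m t : nat) : seq {fset nat} :=
  [seq [fset val i | i in B]%fset | B : {set 'I_m} <-
    enum [set B : {set 'I_m} | #|B| == t]%SET].

Lemma imfset_val_inj m :
  injective (fun B : {set 'I_m} => [fset val i | i in B]%fset).
Proof.
move=> B C /fsetP BC; apply/setP => i; have := BC (val i).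
by rewrite !mem_imfset //=; exact: val_inj.
Qed.

Lemma uniq_draws m t : uniq (draws m t).
Proof. by rewrite map_inj_uniq ?enum_uniq //; exact: imfset_val_inj. Qed.

Lemma size_draws m t : size (draws m t) = 'C(m, t).
Proof. by rewrite size_map -cardE card_draws card_ord. Qed.

Lemma draws_subset m t A : A \in draws m t -> {in A, forall v, v < m}%N.
Proof.
by case/mapP => B _ -> v /imfsetP[i _ ->]; exact: ltn_ord.
Qed.

Lemma uniform_choice_draws (R : realType) theta n A :
  A \in draws (n + theta) theta.-1 ->
  uniform_choice R theta n.+1 A = ('C(n + theta, theta.-1))%:R^-1.
Proof.
move=> dA; rewrite /uniform_choice /= ifT //; apply/andP; split.
  apply/fsubsetP => v /(draws_subset dA) vm.
  by rewrite inE /= mem_iota.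
case/mapP: dA => B; rewrite mem_enum inE => /eqP <- ->.
by rewrite card_imfset ?cardE //=; exact: val_inj.
Qed.

(** The draws avoiding [v] are the [t]-subsets of the complement of [v], which has [m.-1]
    elements. *)
Lemma count_notin_draws m t v : (v < m)%N ->
  count (fun A : {fset nat} => v \notin A) (draws m t) = 'C(m.-1, t).
Proof.
move=> vm; rewrite count_map.
have -> : 'C(m.-1, t) = 'C(#|[set~ Ordinal vm]%SET|, t).
  by rewrite cardsC1 card_ord.
rewrite -cards_draws cardE -size_filter {1}/enum_mem -filter_predI.
rewrite /enum_mem; congr size; apply: eq_filter => B /=.
rewrite !inE -finset.disjoints_subset disjoint_sym disjoints1; congr (~~ _ && _).
by rewrite -[v]/(val (Ordinal vm)) mem_imfset //=; exact: val_inj.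
Qed.

(* The choice S j.+1 is the entry of index j of a history. *)
Fixpoint histories (theta n : nat) : seq (seq {fset nat}) :=
  if n is n'.+1 then
    [seq rcons s A | s <- histories theta n', A <- draws (n' + theta) theta.-1]
  else [:: [::]].

Lemma size_mem_histories theta n s : s \in histories theta n -> size s = n.
Proof.
elim: n s => [|n IHn] s /=; first by rewrite inE => /eqP ->.
by case/allpairsP => -[s' A] [/= /IHn <- _ ->]; rewrite size_rcons.
Qed.

Lemma uniq_histories theta n : uniq (histories theta n).
Proof.
elim: n => //= n IHn; apply: allpairs_uniq => //; first exact: uniq_draws.
by move=> [s A] [s' A'] _ _ /= /rcons_inj[-> ->].
Qed.

Lemma big_historiesS (V : nmodType) theta n (F : seq {fset nat} -> V) :
  \sum_(s <- histories theta n.+1) F s =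
  \sum_(s <- histories theta n) \sum_(A <- draws (n + theta) theta.-1)
    F (rcons s A).
Proof. by rewrite /= big_allpairs_dep. Qed.

(** The common probability of all admissible histories: [j + theta] vertices exist when the vertex
    labeled [j + 1] is inserted. *)
Definition history_weight (R : realType) (theta n : nat) : R :=
  \prod_(0 <= j < n) ('C(j + theta, theta.-1))%:R^-1.

Lemma sum_history_weight (R : realType) theta n :
  \sum_(s <- histories theta n) history_weight R theta n = 1.
Proof.
elim: n => [|n IHn]; first by rewrite big_seq1 /history_weight big_geq.
rewrite big_historiesS -[RHS]IHn; apply: eq_bigr => s _.
rewrite big_const_seq count_predT size_draws iter_addr_0.
rewrite /history_weight big_nat_recr //= -mulrnAr -[X in _ * X]mulr_natl.
by rewrite divff ?mulr1 // pnatr_eq0 -lt0n bin_gt0; lia.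
Qed.

Definition history (T : Type) (S : nat -> T -> {fset nat}) n w :=
  [seq S j w | j <- iota 1 n].

(** Choices are numbered from 1 and list entries from 0, hence the shift [j.-1]. *)
Lemma history_eqP (T : Type) (S : nat -> T -> {fset nat}) n s w :
  size s = n ->
  history S n w = s <->
  forall j, (1 <= j < n.+1)%N -> S j w = nth fset0 s j.-1.
Proof.
move=> sn; split => [<- [|j] // /andP[_ jn]|h].
  by rewrite (nth_map 0%N) ?size_iota ?nth_iota.
apply: (@eq_from_nth _ fset0); rewrite size_map size_iota // => j jn.
by rewrite (nth_map 0%N) ?size_iota ?nth_iota // add1n h.
Qed.

(** * Law of the history of choices *)

Section law_of_history.
Context (R : realType) (d : measure_display) (T : measurableType d).
Context (P : probability T R) (theta : nat) (S : nat -> T -> {fset nat}).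
Hypothesis HS : hyperrecursive_choices P theta S.

Lemma measurable_history n s : measurable [set w | history S n w = s].
Proof.
have [sn|sn] := eqVneq (size s) n; last first.
  rewrite (_ : [set _ | _] = set0); first exact: measurable0.
  apply/seteqP; split => // w /= e; move: sn; rewrite -e.
  by rewrite size_map size_iota eqxx.
rewrite (_ : [set _ | _] = \bigcap_(j in [set j | (1 <= j < n.+1)%N])
    [set w | S j w = nth fset0 s j.-1]).
  by apply: bigcap_measurableType => j /= /andP[j1 _]; exact: (measurable_choice HS).
apply/seteqP; split => w /=; first by move=> /(history_eqP _ _ sn).
by move=> h; apply/(history_eqP _ _ sn).
Qed.

(** By induction: the last choice multiplies the probability of the shorter history by its uniform
    weight. *)
Lemma probability_history n s : s \in histories theta n ->
  P [set w | history S n w = s] = (history_weight R theta n)%:E.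
Proof.
elim: n s => [|n IHn] s.
  rewrite inE => /eqP ->; rewrite /history_weight big_geq //.
  rewrite -(probability_setT P); congr (P _).
  exact/seteqP.
rewrite /= => /allpairsP[[s' A] [/= hs' dA ->]].
have ss' := size_mem_histories hs'.
have srs : size (rcons s' A) = n.+1 by rewrite size_rcons ss'.
pose B j := nth fset0 (rcons s' A) j.-1.
transitivity (P [set w | forall j, (1 <= j <= n.+1)%N -> S j w = B j]).
  by congr (P _); apply/seteqP; split => w /= /(history_eqP _ _ srs).
rewrite (uniform_choice_indep_past HS) //.
rewrite (_ : [set _ | _] = [set w | history S n w = s']); last first.
  apply/seteqP; split => w /= h.
    apply/(history_eqP _ _ ss') => j jn; rewrite h // /B nth_rcons ifT // ss'.
    by lia.
  move=> j jn; move/(history_eqP _ _ ss'): h => -> //.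
  by rewrite /B nth_rcons ifT // ss'; lia.
rewrite IHn // (_ : B n.+1 = A); last by rewrite /B /= nth_rcons ss' ltnn eqxx.
by rewrite uniform_choice_draws // -EFinM /history_weight [in RHS]big_nat_recr.
Qed.

Lemma probability_pred_history n (Q : pred (seq {fset nat})) :
  P [set w | Q (history S n w)] =
  (\sum_(s <- histories theta n | Q s) history_weight R theta n)%:E.
Proof.
rewrite (@probability_pred_finite_support _ _ _ _ _ _ _ _ (histories theta n)).
- rewrite -sumEFin big_seq_cond [RHS]big_seq_cond; apply: eq_bigr => s /andP[hs _].
  exact: probability_history.
- exact: measurable_history.
- exact: uniq_histories.
rewrite -(sum_history_weight R theta n) -sumEFin.
by rewrite big_seq [RHS]big_seq; apply: eq_bigr => s; exact: probability_history.
Qed.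

End law_of_history.

(** * Generating function of the level *)

(** The containment level as a function of the history alone; entry [j] is the choice at time
    [j + 1], made by the vertex [theta + j]. *)
Definition level (theta v : nat) (s : seq {fset nat}) : nat :=
  (v \in originating_hyperedge theta) +
  \sum_(j < size s) (v \in (theta + j)%N |` nth fset0 s j)%fset.

Lemma level_rcons theta v s A :
  level theta v (rcons s A) =
  (level theta v s + (v \in (theta + size s)%N |` A)%fset)%N.
Proof.
rewrite /level size_rcons big_ord_recr addnA /= nth_rcons ltnn eqxx.
congr (_ + _ + _)%N; apply: eq_bigr => j _.
by rewrite nth_rcons ltn_ord.
Qed.

Lemma containment_level_history (T : Type) theta rho
    (S : nat -> T -> {fset nat}) n k w :
  containment_level theta rho S n k w =
  level theta (vertex theta rho k) (history S n w).
Proof.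
rewrite /containment_level /hyperedges /=.
elim: n => [|n IHn]; first by rewrite /level /= big_ord0.
have iE : iota 1 n.+1 = rcons (iota 1 n) n.+1 by have := iotaD 1 n 1; rewrite addn1 cats1.
rewrite /history iE !map_rcons level_rcons -IHn.
by rewrite -cats1 count_cat /= addn0 addnA size_map size_iota.
Qed.

Section generating_function.
Context (R : realType) (theta v : nat).
Hypothesis theta_gt0 : (0 < theta)%N.

(** The probability generating function of the level at age [n], with the weight factored out
    because histories are equiprobable. *)
Definition level_pgf n : {poly R} :=
  history_weight R theta n *: \sum_(s <- histories theta n) 'X^(level theta v s).

(** The generating function of the increment of the level at time [n + 1]. *)
Definition step_pgf n : {poly R} :=
  ('C(n + theta, theta.-1))%:R^-1 *:
  \sum_(A <- draws (n + theta) theta.-1) 'X^(v \in (theta + n)%N |` A)%fset.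

(** The available draws depend on the past only through its length, so the double sum over histories
    and draws factors. *)
Lemma level_pgfS n : level_pgf n.+1 = level_pgf n * step_pgf n.
Proof.
rewrite /level_pgf /step_pgf big_historiesS -scalerAl -scalerAr scalerA.
rewrite /history_weight [in LHS]big_nat_recr //=; congr (_ *: _).
rewrite mulr_suml big_seq [RHS]big_seq; apply: eq_bigr => s hs.
rewrite mulr_sumr; apply: eq_bigr => A _.
by rewrite level_rcons exprD (size_mem_histories hs).
Qed.

Lemma level_pgf_prod n k : (k <= n)%N ->
  level_pgf n = level_pgf k * \prod_(k <= j < n) step_pgf j.
Proof.
elim: n => [|n IHn]; first by rewrite leqn0 => /eqP ->; rewrite big_geq ?mulr1.
rewrite leq_eqVlt => /predU1P[->|kn]; first by rewrite big_geq ?mulr1.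
by rewrite level_pgfS IHn // big_nat_recr //= mulrA.
Qed.

Lemma coef_level_pgf n r : (level_pgf n)`_r =
  \sum_(s <- histories theta n | level theta v s == r) history_weight R theta n.
Proof.
rewrite coefZ coef_sum mulr_sumr [RHS]big_mkcond; apply: eq_bigr => s _.
by rewrite coefXn eq_sym; case: eqP => _; rewrite ?mulr1 ?mulr0.
Qed.

Lemma step_pgf_cst n (b : bool) :
  (forall A, A \in draws (n + theta) theta.-1 ->
    (v \in (theta + n)%N |` A)%fset = b) ->
  step_pgf n = 'X^b.
Proof.
move=> hb; rewrite /step_pgf big_seq (eq_bigr (fun=> 'X^b)); last first.
  by move=> A /hb ->.
rewrite -big_seq big_const_seq count_predT size_draws iter_addr_0.
rewrite -scalerMnr scalerMnl -mulr_natr mulVf ?scale1r // pnatr_eq0 -lt0n bin_gt0.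
by lia.
Qed.

Lemma step_pgf_new n : v = (theta + n)%N -> step_pgf n = 'X.
Proof.
by move=> vE; rewrite (@step_pgf_cst n true) ?expr1 // => A _; rewrite vE !inE eqxx.
Qed.

Lemma step_pgf_future n : (theta + n < v)%N -> step_pgf n = 1.
Proof.
move=> vn; rewrite (@step_pgf_cst n false) ?expr0 // => A dA.
rewrite !inE gtn_eqF //=; apply/negP => /(draws_subset dA).
by rewrite ltnNge addnC ltnW.
Qed.

(** With [m] vertices and draws of size [t], a fraction [(m - t) / m] of the draws avoids [v], and
    [m - t = n + 1]; the others contain it. *)
Lemma step_pgf_existing n : (v < n + theta)%N ->
  step_pgf n = (n + theta)%:R^-1 *: (n.+1%:R%:P + theta.-1%:R *: 'X).
Proof.
move=> vn; rewrite /step_pgf; set m := (n + theta)%N; set t := theta.-1.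
rewrite (bigID (fun A : {fset nat} => v \notin A)) /=.
have vNn : (v == (theta + n)%N) = false by apply/eqP; lia.
rewrite (eq_bigr (fun=> 1)); last by move=> A /negPf vA; rewrite !inE vNn vA.
rewrite [X in _ + X](eq_bigr (fun=> 'X)); last first.
  by move=> A /negPn vA; rewrite !inE vA orbT.
rewrite !big_const_seq !iter_addr_0 count_notin_draws //.
have -> : count (fun A : {fset nat} => ~~ (v \notin A)) (draws m t) =
    ('C(m, t) - 'C(m.-1, t))%N.
  have := count_predC (fun A : {fset nat} => v \notin A) (draws m t).
  by rewrite size_draws count_notin_draws // => <-; rewrite addKn.
have C0 : 'C(m, t)%:R != 0 :> R by rewrite pnatr_eq0 -lt0n bin_gt0; lia.
have m0 : m%:R != 0 :> R by rewrite pnatr_eq0; lia.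
have cC : ('C(m.-1, t) <= 'C(m, t))%N by apply: leq_bin2l; lia.
(* Absorption identity for binomials, giving the fraction of draws that avoid [v]. *)
have mC : m%:R * 'C(m.-1, t)%:R = n.+1%:R * 'C(m, t)%:R :> R.
  by rewrite -!natrM mul_bin_down; congr (_ * _)%:R; lia.
have mE : m%:R = n.+1%:R + t%:R :> R by rewrite -natrD; congr _%:R; lia.
have e1 : 'C(m, t)%:R^-1 * 'C(m.-1, t)%:R = m%:R^-1 * n.+1%:R :> R.
  apply: (mulfI C0); apply: (mulfI m0); rewrite mulVKf // mC.
  by rewrite mulrCA mulVKf // mulrC.
rewrite !scalerDr scalerA -!scalerMnr !scalerMnl.
rewrite -[_^-1 *+ _]mulr_natr -[_^-1 *+ (_ - _)]mulr_natr natrB // e1.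
congr (_ + _); first by rewrite -alg_polyC scalerA.
congr (_ *: _); rewrite mulrBr e1 mulVf //.
by apply: (mulfI m0); rewrite mulrBr !mulVKf // mulr1 mE; ring.
Qed.

Lemma level_pgf0 : level_pgf 0 = 'X^(v < theta)%N.
Proof.
rewrite /level_pgf /history_weight big_geq // scale1r /= big_seq1 /level.
by rewrite big_ord0 addn0 /originating_hyperedge inE /= mem_iota.
Qed.

End generating_function.

Lemma vertex_existing theta rho k n : (rho < theta)%N -> (k <= n)%N ->
  (vertex theta rho k < n + theta)%N.
Proof. by case: k => [|k] /=; lia. Qed.

(* The originator is in the initial hyperedge, a later vertex k enters with the
   k-th one; either way its level is 1 at age k. *)
Lemma level_pgf_birth (R : realType) theta rho k : (rho < theta)%N ->
  level_pgf R theta (vertex theta rho k) k = 'X.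
Proof.
move=> rt; have t0 : (0 < theta)%N by lia.
case: k => [|k] /=; first by rewrite level_pgf0 rt.
rewrite level_pgfS // step_pgf_new // (@level_pgf_prod _ _ _ _ 0) //.
rewrite level_pgf0 ltnNge leq_addr mul1r big_nat big1 ?mul1r // => j /andP[_ jk].
by rewrite step_pgf_future // ltn_add2l.
Qed.

(** The vertex exists from age [k] on, so every later step has the linear form of
    [step_pgf_existing]; numerators and denominators each multiply to a rising factorial. *)
Lemma level_pgf_rising_factorial (R : realType) theta rho k n :
  (rho < theta)%N -> (k <= n)%N ->
  level_pgf R theta (vertex theta rho k) n =
  (rising_factorial (k + theta)%:R (n - k))^-1 *:
  ('X * rising_factorial (k.+1%:R%:P + theta.-1%:R *: 'X) (n - k)).
Proof.
move=> rt kn; have t0 : (0 < theta)%N by lia.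
rewrite (@level_pgf_prod _ _ _ _ _ kn) level_pgf_birth // scalerAr; congr (_ * _).
rewrite /rising_factorial -{1}[k]add0n big_addn -prodfV -scaler_prod.
apply: eq_bigr => j _; rewrite step_pgf_existing //; last first.
  by apply: vertex_existing => //; lia.
rewrite addrAC -polyC_natr -polyCD -!natrD.
by congr (_%:R^-1 *: (_%:R%:P + _)); lia.
Qed.

(** * Extraction of the coefficient *)

Lemma coef_linear_exp (A : comNzRingType) (a b : A) i j :
  ((a%:P + b *: 'X) ^+ i)`_j = ('C(i, j))%:R * a ^+ (i - j) * b ^+ j.
Proof.
rewrite exprDn coef_sum.
under eq_bigr => l _.
  rewrite coefMn -polyC_exp mul_polyC exprZn scalerA coefZ coefXn.
  over.
(* For [j <= i] only the binomial term of index [j] survives; for [j > i] no term has degree [j] and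
   the binomial coefficient is 0. *)
have [ji|ij] := ltnP j i.+1; last first.
  rewrite bin_small // !mul0r big1 // => l _.
  by rewrite gtn_eqF ?mulr0 ?mul0rn // (leq_ltn_trans _ ij) // -ltnS.
rewrite (bigD1 (Ordinal ji)) //= eqxx mulr1 big1 ?addr0 => [|l lj].
  by ring.
by rewrite -val_eqE /= in lj; rewrite eq_sym (negPf lj) mulr0 mul0rn.
Qed.

Theorem theorem4p1 (R : realType) (d : measure_display) (T : measurableType d)
    (P : probability T R) (theta : nat) (S : nat -> T -> {fset nat})
    (rho n k r : nat) :
  (2 <= theta)%N ->
  hyperrecursive_choices P theta S ->
  (rho < theta)%N ->
  (1 <= n)%N ->
  (k <= n)%N ->
  (1 <= r)%N ->
  P [set w | containment_level theta rho S n k w = r] =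
  ((theta.-1)%:R ^+ r.-1 / rising_factorial (k + theta)%:R (n - k) *
   \sum_(r.-1 <= i < (n - k).+1)
     (stirling1 (n - k) i)%:R * ('C(i, r.-1))%:R * (k.+1)%:R ^+ (i - r.-1))%:E.
Proof.
move=> _ HS rt _ kn r0.
pose Q s := level theta (vertex theta rho k) s == r.
rewrite (_ : [set w | _] = [set w | Q (history S n w)]); last first.
  by apply/seteqP; split => w /=; rewrite containment_level_history => /eqP.
rewrite (probability_pred_history HS) -coef_level_pgf; congr EFin.
(* The factor ['X], coming from the hyperedge that contains the vertex at birth, shifts the
   coefficient from [r] to [r.-1]. *)
rewrite level_pgf_rising_factorial // coefZ coefXM eqn0Ngt r0 /=.
rewrite (rising_factorial_stirling1 (_ + _)) coef_sum -[RHS]mulrA [RHS]mulrCA.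
congr (_ * _).
(* The sum can start at 0: for [i < r.-1] the coefficient on the left vanishes with
   ['C(i, r.-1)]. *)
rewrite mulr_sumr (big_nat_widenl _ _ _ _ _ (leq0n r.-1)) big_mkcond big_mkord.
apply: eq_bigr => i _ /=; rewrite mulr_natl coefMn coef_linear_exp.
by case: leqP => [_|/bin_small ->]; [ring|rewrite !mul0r mul0rn].
Qed.
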